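(* The group $Fr(162\times 4)=\langle G_1,G_2,FUM\rangle\subset SU(3)$ is finite of order $648$ and contains $Fr(162)=\langle G_1,G_2\rangle$ (a group isomorphic to $D(9,1,1;2,1,1)$) as a subgroup. More precisely: (a) $\mathcal N\mathcal V=\{NT: N\in\mathcal N, T\in\mathcal V\}$ is a normal subgroup of $Fr(162\times 4)$, isomorphic to $\mathcal N\times\mathcal V\cong \mathbb Z/18\mathbb Z\times\mathbb Z/6\mathbb Z$; $\mathcal H$ is a subgroup isomorphic to $S_3$; $\mathcal N\mathcal V\cap\mathcal H=\{I_3\}$; and $Fr(162\times 4)=(\mathcal N\mathcal V)\rtimes\mathcal H$, the action being by conjugation. (b) Every element of $Fr(162\times 4)$ can be written uniquely as $A^iB^jTH$ with $0\le i\le 8$, $0\le j\le 2$, $T\in\mathcal V$, $H\in\mathcal H$. (c) With $C_{18}=A\,(FUM)^3$ and $C_6=B\,G_1(FUM)^3G_1^{-1}$, the group $Fr(162\times 4)$ has the presentation $$\left\langle C_6,C_{18},H_1,H_3\ \middle|\ \begin{array}{l}C_6^6=C_{18}^{18}=[C_6,C_{18}]=H_1^2=H_3^3=(H_1H_3)^2=1,\\ H_1C_6H_1^{-1}=C_6^{-1}C_{18}^6,\quad H_1C_{18}H_1^{-1}=C_6^3C_{18},\\ H_3C_6H_3^{-1}=C_6C_{18}^{-3},\quad H_3C_{18}H_3^{-1}=C_6C_{18}^{10}\end{array}\right\rangle .$$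
   Context: Let $\omega=e^{2i\pi/3}$ and let $J$ be the $3\times3$ antidiagonal matrix with all antidiagonal entries $1$. Define $G_1=\mathrm{diag}(e^{7i\pi/9},-e^{4i\pi/9},-e^{7i\pi/9})$, $G_2=\begin{pmatrix}-\tfrac12 e^{4i\pi/9}&\tfrac{1}{\sqrt2}e^{7i\pi/9}&\tfrac12 e^{4i\pi/9}\\ \tfrac{1}{\sqrt2}e^{7i\pi/9}&0&\tfrac{1}{\sqrt2}e^{7i\pi/9}\\ \tfrac12 e^{4i\pi/9}&\tfrac{1}{\sqrt2}e^{7i\pi/9}&-\tfrac12 e^{4i\pi/9}\end{pmatrix}$, $FUM=-\omega J$. Let $A=\tfrac12 e^{5i\pi/9}\begin{pmatrix}-1+e^{i\pi/3}&0&1+e^{i\pi/3}\\0&-2&0\\1+e^{i\pi/3}&0&-1+e^{i\pi/3}\end{pmatrix}$ and $B=\tfrac12\begin{pmatrix}1+\omega&0&-1+\omega\\0&-2e^{i\pi/3}&0\\-1+\omega&0&1+\omega\end{pmatrix}$ (one has $A=G_1G_2^2G_1^{-1}$, $B=G_1G_2^{-2}G_1$), and $\mathcal N=\langle A,B\rangle$. Let $H_0=\mathrm{diag}(-1,-1,1)$, $H_1=\begin{pmatrix}-\frac12&-\frac1{\sqrt2}&-\frac12\\-\frac1{\sqrt2}&0&\frac1{\sqrt2}\\-\frac12&\frac1{\sqrt2}&-\frac12\end{pmatrix}$, $H_2=\begin{pmatrix}-\frac12&-\frac1{\sqrt2}&\frac12\\-\frac1{\sqrt2}&0&-\frac1{\sqrt2}\\\frac12&-\frac1{\sqrt2}&-\frac12\end{pmatrix}$,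 $H_3=\begin{pmatrix}\frac12&\frac1{\sqrt2}&-\frac12\\\frac1{\sqrt2}&0&\frac1{\sqrt2}\\\frac12&-\frac1{\sqrt2}&-\frac12\end{pmatrix}$, $H_4=\begin{pmatrix}\frac12&\frac1{\sqrt2}&\frac12\\\frac1{\sqrt2}&0&-\frac1{\sqrt2}\\-\frac12&\frac1{\sqrt2}&-\frac12\end{pmatrix}$, and $\mathcal H=\{I_3,H_0,H_1,H_2,H_3,H_4\}$. Let $\mathcal V=\{I_3,V_2,V_3,V_4\}$ with $V_2=(FUM)^3=-J$, $V_3=G_1(FUM)^3G_1^{-1}=\begin{pmatrix}0&0&1\\0&-1&0\\1&0&0\end{pmatrix}$, $V_4=V_3V_2=\mathrm{diag}(-1,1,-1)$ (a Klein four-group). $D(9,1,1;2,1,1)$ is the subgroup of $SU(3)$ generated by $\mathrm{diag}(e^{2i\pi/9},e^{2i\pi/9},e^{-4i\pi/9})$, $E=\begin{pmatrix}0&1&0\\0&0&1\\1&0&0\end{pmatrix}$ and $\tilde B=\begin{pmatrix}-1&0&0\\0&0&-1\\0&-1&0\end{pmatrix}$. *)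

(* Defs.v *)
(* matrices over algC (algebraic complex numbers). *)
From HB Require Import structures.
From mathcomp Require Import all_boot all_order all_algebra all_fingroup all_field.
Set Implicit Arguments. Unset Strict Implicit. Unset Printing Implicit Defensive.
Import Order.TTheory GRing.Theory Num.Theory.
Local Open Scope ring_scope.

Notation Mx := ('M[algC]_3).

(* z = e^{i pi/9}: the 9th root of -1 with minimal non-negative argument. *)
Definition z : algC := 9.-root (-1).
Definition s2 : algC := sqrtC 2.
Definition omega : algC := z ^+ 6.           (* e^{2 i pi/3} *)
Definition half : algC := 2^-1.

Definition mx3 (a b c d e f g h k : algC) : Mx :=
  \matrix_(i < 3, j < 3)
    nth 0 (nth [::] [:: [:: a; b; c]; [:: d; e; f]; [:: g; h; k]] i) j.

Definition Jm : Mx := mx3 0 0 1  0 1 0  1 0 0.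

Definition G1 : Mx := mx3 (z ^+ 7) 0 0  0 (- z ^+ 4) 0  0 0 (- z ^+ 7).
Definition G2 : Mx :=
  mx3 (- half * z ^+ 4) (s2^-1 * z ^+ 7) (half * z ^+ 4)
      (s2^-1 * z ^+ 7) 0 (s2^-1 * z ^+ 7)
      (half * z ^+ 4) (s2^-1 * z ^+ 7) (- half * z ^+ 4).
Definition FUM : Mx := (- omega) *: Jm.

Definition Am : Mx := (half * z ^+ 5) *:
  mx3 (-1 + z ^+ 3) 0 (1 + z ^+ 3)  0 (-2) 0  (1 + z ^+ 3) 0 (-1 + z ^+ 3).
Definition Bm : Mx := half *:
  mx3 (1 + omega) 0 (-1 + omega)  0 (-2 * z ^+ 3) 0  (-1 + omega) 0 (1 + omega).

Definition H0 : Mx := mx3 (-1) 0 0  0 (-1) 0  0 0 1.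
Definition H1 : Mx := mx3 (- half) (- s2^-1) (- half)  (- s2^-1) 0 (s2^-1)
                          (- half) (s2^-1) (- half).
Definition H2 : Mx := mx3 (- half) (- s2^-1) half  (- s2^-1) 0 (- s2^-1)
                          half (- s2^-1) (- half).
Definition H3 : Mx := mx3 half (s2^-1) (- half)  (s2^-1) 0 (s2^-1)
                          half (- s2^-1) (- half).
Definition H4 : Mx := mx3 half (s2^-1) half  (s2^-1) 0 (- s2^-1)
                          (- half) (s2^-1) (- half).
Definition Hlist : seq Mx := [:: 1; H0; H1; H2; H3; H4].

Definition V2 : Mx := FUM ^+ 3.
Definition V3 : Mx := G1 * FUM ^+ 3 * G1^-1.
Definition V4 : Mx := V3 * V2.
Definition Vlist : seq Mx := [:: 1; V2; V3; V4].

(* generators of D(9,1,1;2,1,1) *)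
Definition Dg1 : Mx := mx3 (z ^+ 2) 0 0  0 (z ^+ 2) 0  0 0 (z ^- 4).
Definition Em : Mx := mx3 0 1 0  0 0 1  1 0 0.
Definition Btil : Mx := mx3 (-1) 0 0  0 0 (-1)  0 (-1) 0.

Definition C18 : Mx := Am * FUM ^+ 3.
Definition C6 : Mx := Bm * (G1 * FUM ^+ 3 * G1^-1).

(* The subgroup of GL_3(algC) generated by a list of matrices. *)
Inductive gen (S : seq Mx) : Mx -> Prop :=
| gen_base M : M \in S -> gen S M
| gen_one : gen S 1
| gen_mul M N : gen S M -> gen S N -> gen S (M * N)
| gen_inv M : gen S M -> gen S M^-1.

Definition Fr648 := gen [:: G1; G2; FUM].
Definition Fr162 := gen [:: G1; G2].
Definition Ngrp := gen [:: Am; Bm].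
Definition Dgrp := gen [:: Dg1; Em; Btil].
Definition NV (M : Mx) : Prop :=
  exists N T, Ngrp N /\ T \in Vlist /\ M = N * T.

(* conjugate transpose *)
Definition adjM (M : Mx) : Mx := (map_mx (fun x : algC => x^*) M)^T.

(* A (sub)set P of matrices has exactly n elements. *)
Definition has_order (P : Mx -> Prop) (n : nat) : Prop :=
  exists s : seq Mx, uniq s /\ size s = n /\ forall M, P M <-> M \in s.

(* Abstract groups given by carrier and operations. *)
Definition is_group (T : Type) (mul : T -> T -> T) (one : T) (inv : T -> T) :=
  [/\ forall x y w, mul x (mul y w) = mul (mul x y) w,
      forall x, mul one x = x, forall x, mul x one = x,
      forall x, mul (inv x) x = one & forall x, mul x (inv x) = one].

Fixpoint gpow (T : Type) (mul : T -> T -> T) (one : T) (x : T) (n : nat) : T :=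
  match n with 0 => one | n.+1 => mul x (gpow mul one x n) end.

(* The relations of the presentation, for generators c6 c18 h1 h3.
   The commutator [a,b] is a b a^-1 b^-1. *)
Definition pres_rels (T : Type) (mul : T -> T -> T) (one : T) (inv : T -> T)
    (c6 c18 h1 h3 : T) : Prop :=
  let pw := gpow mul one in
  pw c6 6 = one /\ pw c18 18 = one /\
  mul (mul c6 c18) (mul (inv c6) (inv c18)) = one /\
  pw h1 2 = one /\ pw h3 3 = one /\ pw (mul h1 h3) 2 = one /\
  mul (mul h1 c6) (inv h1) = mul (inv c6) (pw c18 6) /\
  mul (mul h1 c18) (inv h1) = mul (pw c6 3) c18 /\
  mul (mul h3 c6) (inv h3) = mul c6 (inv (pw c18 3)) /\
  mul (mul h3 c18) (inv h3) = mul c6 (pw c18 10).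

(* Main.v *)
(** In the orthonormal basis ((e1 + e3)/sqrt 2, e2, (e1 - e3)/sqrt 2) all the
    matrices involved become monomial, with nonzero entries powers of
    z = e^{i pi/9}. Writing such a matrix as diag(z^e) (sgn s) P_s, where P_s is
    the permutation matrix of s : 'S_3, the group Fr(162x4) consists of exactly
    those monomial matrices for which e_1, e_2, e_3 are congruent mod 3 and
    e_1 + e_2 + e_3 = 0 mod 18; NV is the subgroup s = 1 (of order 108), H is the
    subgroup e = 0, and Fr(162) is the subgroup where moreover all e_i are even.
    The very same monomial matrices, read in the standard basis, generate
    D(9,1,1;2,1,1), so that the change of basis is the isomorphism
    Fr(162) ~ D(9,1,1;2,1,1). For the presentation, the relations suffice to bring
    every word to the form C18^i C6^j H1^a H3^b, and in Fr(162x4) the exponents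
    of this form are unique. *)

Require Import Defs.
From HB Require Import structures.
From mathcomp Require Import all_boot all_order all_algebra all_fingroup all_field.
From mathcomp Require Import cyclic.
From mathcomp Require Import ring zify.
Import Order.TTheory GRing.Theory Num.Theory.
Local Open Scope ring_scope.
Set Implicit Arguments.
Unset Strict Implicit.
Unset Printing Implicit Defensive.

(** * The root of unity z *)

Lemma z_exp9 : z ^+ 9 = -1.
Proof. exact: rootCK. Qed.

Lemma norm1_of_exp (w : algC) n : (0 < n)%N -> `|w ^+ n| = 1 -> `|w| = 1.
Proof.
move=> n_gt0; rewrite normrX => wn; apply/eqP.
by rewrite -(@pexpr_eq1 _ _ n) ?wn ?normr_ge0.
Qed.

Lemma normC_sub1 (w : algC) : `|w| = 1 -> `|w - 1| ^+ 2 = 2 - 2 * 'Re w.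
Proof.
move=> w1; rewrite normCK rmorphB rmorph1 /= ReE.
have ww : w * w^* = 1 by rewrite -normCK w1 expr1n.
by field: ww.
Qed.

(** Conjugation permutes the roots of X^9 + 1, and [9.-root] has the largest real part among those
    in the closed upper half plane; on the unit circle a larger real part means a smaller distance
    to 1. *)
Lemma z_nearest_1 (w : algC) : w ^+ 9 = -1 -> `|z - 1| <= `|w - 1|.
Proof.
move=> w9.
have n1 (u : algC) : u ^+ 9 = -1 -> `|u| = 1.
  by move=> u9; apply: (@norm1_of_exp _ 9) => //; rewrite u9 normrN1.
rewrite -(@ler_pXn2r _ 2) ?nnegrE ?normr_ge0 // !normC_sub1 ?n1 ?z_exp9 //.
rewrite lerD2l lerN2 ler_pM2l ?ltr0n //.
have [Iw|Iw] := real_leP (@real0 algC) (Creal_Im w).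
  exact: rootC_Re_max.
have <- : 'Re w^* = 'Re w by rewrite Re_conj.
apply: rootC_Re_max => //; last by rewrite Im_conj oppr_ge0 ltW.
by rewrite -rmorphXn w9 rmorphN rmorph1.
Qed.

(* [9.-root] only fixes z as the root of X^9 + 1 of maximal real part, i.e. the
   closest to 1. If z^3 = -1, the three cube roots y of z are also roots of
   X^9 + 1, and the product of their distances to 1 is |y^3 - 1| = |z - 1|, so
   |z - 1| <= 1; then |z - 1| = 1 and |y - 1| = 1, which forces y^3 = -1 <> z. *)
Lemma z_exp3_neqN1 : z ^+ 3 != -1.
Proof.
apply/eqP => z3.
pose y : algC := 3.-root z.
have y3 : y ^+ 3 = z by rewrite rootCK.
have [w w3 w1] : exists2 w : algC, w ^+ 3 = 1 & w ^+ 2 = - w - 1.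
  have [w pw] := C_prim_root_exists (isT : 0 < 3)%N.
  have w3 := prim_expr_order pw; exists w => //.
  have w_neq1 : w - 1 != 0.
    rewrite subr_eq0; apply/eqP => w1; have := eq_prim_root_expr pw 1 0.
    by rewrite w1 !expr1n eqxx.
  by apply: (mulfI w_neq1); ring: w3.
have y9 k : (w ^+ k * y) ^+ 9 = -1.
  by rewrite exprMn exprAC (exprM w 3 3) w3 !expr1n mul1r (exprM y 3 3) y3.
have near k := z_nearest_1 (y9 k).
have prodE : `|w ^+ 0 * y - 1| * `|w ^+ 1 * y - 1| * `|w ^+ 2 * y - 1| = `|z - 1|.
  rewrite -!normrM; congr `|_|; rewrite -y3.
  by ring: w1.
have n0 := near 0%N; have n1 := near 1%N; have n2 := near 2%N.
have y1 : `|y| = 1.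
  by apply: (@norm1_of_exp _ 9) => //; rewrite -[y]mul1r -(expr0 w) y9 normrN1.
rewrite expr0 mul1r in n0 prodE.
(* Now z = -1 or z^2 - z + 1 = 0. In the first case three distances of at least 2 would have product
   2; in the second, z - 1 = z^2 has modulus 1. *)
have [zN1|zN1] := eqVneq z (-1).
  move: prodE n0 n1 n2; rewrite zN1.
  have -> : -1 - 1 = - 2 :> algC by ring.
  rewrite normrN normr_nat => e n0 n1 n2.
  have := ler_pM _ _ (ler_pM _ _ n0 n1) n2; rewrite e ?mulr_ge0 ?ler0n // -!natrM ler_nat.
  by move/(_ isT isT isT isT).
have z1 : `|z - 1| = 1.
  have zz : z - 1 = z ^+ 2.
    apply/eqP; rewrite -subr_eq0 -(mulrI_eq0 _ (mulfI (_ : z + 1 != 0))) ?addr_eq0 //.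
    by apply/eqP; ring: z3.
  by rewrite zz normrX (@norm1_of_exp z 9) ?z_exp9 ?normrN1 ?expr1n.
rewrite z1 in prodE n0 n1 n2.
have y11 : `|y - 1| = 1.
  apply/le_anti/andP; split => //.
  rewrite -[X in _ <= X]prodE -mulrA ler_peMr ?normr_ge0 //.
  by rewrite mulr_ege1.
have := normC_sub1 y1; rewrite y11 expr1n => eRe.
have yc : y + y^* = 1.
  have -> : y + y^* = 2 - (2 - 2 * 'Re y) by rewrite ReE; field.
  by rewrite -eRe; ring.
have yy : y * y^* = 1 by rewrite -normCK y1 expr1n.
case/eqP: zN1; rewrite -y3.
have y2 : y ^+ 2 = y - 1.
  by rewrite -yy -{2}[y]mulr1 -yc; ring.
by ring: y2.
Qed.

(** The order divides 18. It does not divide 9, since z^9 = -1, nor 6, since z^6 = 1 would give z^3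
    = z^9 = -1. *)
Lemma z_prim : 18.-primitive_root z.
Proof.
have z18 : z ^+ 18 = 1 by rewrite (exprM z 9 2) z_exp9 sqrrN expr1n.
have N1_neq1 : -1 != 1 :> algC by rewrite eqNr oner_eq0.
have [d pd d18] := prim_order_exists (isT : 0 < 18)%N z18.
have d9 : ~~ (d %| 9)%N by rewrite (prim_order_dvd pd) z_exp9.
have d6 : ~~ (d %| 6)%N.
  rewrite (prim_order_dvd pd); apply: contra z_exp3_neqN1 => /eqP z6.
  by rewrite -z_exp9 (exprD z 3 6) z6 mulr1.
have: d \in divisors 18 by rewrite -dvdn_divisors.
rewrite (_ : divisors 18 = [:: 1; 2; 3; 6; 9; 18]%N) // !inE.
by do 5![case/predU1P => [ed|]; first by rewrite ed in d9 d6] => /eqP <-.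
Qed.

Lemma zX_eq i j : (z ^+ i == z ^+ j) = (i == j %[mod 18])%N.
Proof. exact: eq_prim_root_expr z_prim i j. Qed.

Lemma z_neq0 : z != 0.
Proof. by move: (oner_eq0 algC); rewrite -oppr_eq0 -z_exp9 expf_eq0 /= => ->. Qed.

(** * Monomial matrices *)

Lemma mulmx1_invr n (X Y : 'M[algC]_n.+1) : X * Y = 1 -> X^-1 = Y.
Proof.
move=> XY; have [uX _] := mulmx1_unit XY.
by rewrite -[Y](mulKr uX) XY mulr1.
Qed.

Lemma mx3M a b c d e f g h k a' b' c' d' e' f' g' h' k' :
  mx3 a b c d e f g h k * mx3 a' b' c' d' e' f' g' h' k' =
  mx3 (a * a' + b * d' + c * g') (a * b' + b * e' + c * h') (a * c' + b * f' + c * k')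
      (d * a' + e * d' + f * g') (d * b' + e * e' + f * h') (d * c' + e * f' + f * k')
      (g * a' + h * d' + k * g') (g * b' + h * e' + k * h') (g * c' + h * f' + k * k').
Proof.
apply/matrixP => i j; rewrite !mxE !big_ord_recl big_ord0 !mxE /= addr0 addrA.
by case: i j => [[|[|[|]]]] //= _ [[|[|[|]]]].
Qed.

Lemma mx3Z u a b c d e f g h k : u *: mx3 a b c d e f g h k =
  mx3 (u * a) (u * b) (u * c) (u * d) (u * e) (u * f) (u * g) (u * h) (u * k).
Proof.
apply/matrixP => i j; rewrite !mxE.
by case: i j => [[|[|[|]]]] //= _ [[|[|[|]]]].
Qed.

Lemma mx3_1 : mx3 1 0 0 0 1 0 0 0 1 = 1.
Proof.
apply/matrixP => i j; rewrite !mxE.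
by case: i j => [[|[|[|]]]] //= ? [[|[|[|]]]].
Qed.

Local Notation r := (s2^-1).

Lemma s2V_sqr : r ^+ 2 = Defs.half.
Proof. by rewrite exprVn sqrtCK. Qed.

Lemma half2 : 2 * Defs.half = 1.
Proof. by rewrite divff ?pnatr_eq0. Qed.

(* Orthogonal and symmetric, hence its own inverse. *)
Definition Pmx : Mx := mx3 r 0 r 0 1 0 r 0 (- r).

Lemma PmxK : Pmx * Pmx = 1.
Proof.
rewrite /Pmx mx3M -mx3_1.
by congr mx3; ring: s2V_sqr half2.
Qed.

Definition conjP (X : Mx) : Mx := Pmx * X * Pmx.

Lemma conjP1 : conjP 1 = 1.
Proof. by rewrite /conjP mulr1 PmxK. Qed.

Lemma conjPK : involutive conjP.
Proof. by move=> X; rewrite /conjP !mulrA PmxK mul1r -mulrA PmxK mulr1. Qed.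

Lemma conjPM X Y : conjP (X * Y) = conjP X * conjP Y.
Proof. by rewrite /conjP !mulrA -[Pmx * X * Pmx * Pmx]mulrA PmxK mulr1. Qed.

Definition tri (a b c : nat) (i : 'I_3) : nat := nth 0 [:: a; b; c] i.

(** Exponents are natural numbers read modulo 18: identities of matrices become congruences within
    reach of [lia], and negation is multiplication by 17. *)
Definition diagz (e : 'I_3 -> nat) : Mx := diag_mx (\row_i z ^+ e i).
(** The factor (-1)^s makes the determinant 1: in dimension 3 it enters cubed and cancels the sign
    of the permutation. *)
Definition sgnperm (s : 'S_3) : Mx := (-1) ^+ s *: perm_mx s.

Lemma diagz_eqP (e e' : 'I_3 -> nat) :
  diagz e = diagz e' <-> forall i, (e i = e' i %[mod 18])%N.
Proof.
split=> [/matrixP eq i | eq].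
  by have := eq i i; rewrite !mxE eqxx => /eqP; rewrite zX_eq => /eqP.
congr diag_mx; apply/rowP => i; rewrite !mxE.
by apply/eqP; rewrite zX_eq; apply/eqP.
Qed.

Lemma diagz0 : diagz (fun=> 0%N) = 1.
Proof. by apply/matrixP => i j; rewrite !mxE. Qed.

Lemma diagzM e e' : diagz e * diagz e' = diagz (fun i => e i + e' i)%N.
Proof.
rewrite -mulmxE mulmx_diag; congr diag_mx; apply/rowP => i.
by rewrite !mxE exprD.
Qed.

Lemma diagzX e n : diagz e ^+ n = diagz (fun i => n * e i)%N.
Proof.
elim: n => [|n IHn]; first by rewrite expr0 -diagz0; apply/diagz_eqP.
by rewrite exprS IHn diagzM; apply/diagz_eqP => i.
Qed.

Lemma sgnperm1 : sgnperm 1 = 1.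
Proof. by rewrite /sgnperm odd_perm1 expr0 scale1r perm_mx1. Qed.

Lemma sgnpermM s t : sgnperm (s * t)%g = sgnperm s * sgnperm t.
Proof.
by rewrite /sgnperm perm_mxM odd_permM signr_addb -mulmxE -scalemxAl -scalemxAr scalerA.
Qed.

Lemma sgnperm_diagz s e : sgnperm s * diagz e = diagz (e \o s) * sgnperm s.
Proof.
apply/matrixP => i j; rewrite -!mulmxE mul_mx_diag mul_diag_mx !mxE /=.
by case: eqP => [->|]; rewrite ?mulr0 ?mul0r // mulrC.
Qed.

Lemma diagz_sgnperm_inj e e' s s' :
  diagz e * sgnperm s = diagz e' * sgnperm s' ->
  (forall i, (e i = e' i %[mod 18])%N) /\ s = s'.
Proof.
move=> /matrixP eq.
have eqij i j := eq i j; move: eqij; rewrite -!mulmxE !mul_diag_mx => eqij.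
have zX_neq0 n : z ^+ n != 0 by rewrite expf_neq0 ?z_neq0.
(* The entry (i, s i) is non-zero on the left, hence also on the right, where row i is supported in
   column s' i. *)
have ss' : s = s'.
  apply/permP => i; apply/eqP; have := eqij i (s i); rewrite !mxE eqxx eq_sym.
  case: eqP => // _ /eqP; rewrite !mulr0 mulr1 mulf_eq0 signr_eq0 orbF.
  by rewrite (negPf (zX_neq0 _)).
split=> // i; have := eqij i (s i); rewrite !mxE -ss' eqxx.
by move/(mulIf _)/eqP; rewrite mulr1 signr_eq0 zX_eq => /(_ isT)/eqP.
Qed.

Definition mono (e : 'I_3 -> nat) (s : 'S_3) : Mx := conjP (diagz e * sgnperm s).

Lemma mono_eqP e e' s s' :
  mono e s = mono e' s' <-> (forall i, (e i = e' i %[mod 18])%N) /\ s = s'.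
Proof.
split=> [/(can_inj conjPK)/diagz_sgnperm_inj // | [/diagz_eqP ee' <-]].
by rewrite /mono ee'.
Qed.

(** This is the law of a semidirect product of exponent vectors by S_3; it turns later matrix
    computations into congruences and identities of permutations. *)
Lemma monoM e e' s s' :
  mono e s * mono e' s' = mono (fun i => e i + e' (s i))%N (s * s')%g.
Proof.
rewrite /mono -conjPM -mulrA (mulrA (sgnperm s)) sgnperm_diagz.
by rewrite -mulrA -sgnpermM mulrA diagzM.
Qed.

Lemma mono1 : mono (fun=> 0%N) 1 = 1.
Proof. by rewrite /mono diagz0 sgnperm1 mulr1 conjP1. Qed.

Lemma monoX e n : mono e 1 ^+ n = mono (fun i => n * e i)%N 1.
Proof.
elim: n => [|n IHn]; first by rewrite expr0 -mono1.
rewrite exprS IHn monoM mulg1; apply/mono_eqP; split=> // i.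
by rewrite perm1 mulSn.
Qed.

Lemma monoV e s : (mono e s)^-1 = mono (fun i => 17 * e (s^-1%g i))%N s^-1.
Proof.
apply: mulmx1_invr; rewrite monoM mulgV -mono1; apply/mono_eqP; split=> // i.
by rewrite permK -mulSn modnMr.
Qed.

Lemma mono_unit e s : mono e s \is a GRing.unit.
Proof.
have [] // := @mulmx1_unit _ _ (mono e s) (mono (fun i => 17 * e (s^-1%g i))%N s^-1).
rewrite mulmxE monoM mulgV -[RHS]mono1; apply/mono_eqP; split=> // i.
by rewrite permK -mulSn modnMr.
Qed.

Lemma diagz_tri a b c : diagz (tri a b c) = mx3 (z ^+ a) 0 0 0 (z ^+ b) 0 0 0 (z ^+ c).
Proof.
apply/matrixP => i j; rewrite !mxE.
by case: i j => [[|[|[|]]]] //= ? [[|[|[|]]]].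
Qed.

Definition t02 : 'S_3 := tperm 0 2.
Definition t12 : 'S_3 := tperm 1 2.
Definition t01 : 'S_3 := tperm 0 1.

Lemma sgnperm_t02 : sgnperm t02 = mx3 0 0 (-1) 0 (-1) 0 (-1) 0 0.
Proof.
apply/matrixP => i j; rewrite /sgnperm odd_tperm expr1 !mxE permE /=.
by case: i j => [[|[|[|]]]] //= ? [[|[|[|]]]] //= ?; rewrite ?mulr1 ?mulr0.
Qed.

Lemma sgnperm_t12 : sgnperm t12 = mx3 (-1) 0 0 0 0 (-1) 0 (-1) 0.
Proof.
apply/matrixP => i j; rewrite /sgnperm odd_tperm expr1 !mxE permE /=.
by case: i j => [[|[|[|]]]] //= ? [[|[|[|]]]] //= ?; rewrite ?mulr1 ?mulr0.
Qed.

Lemma sgnperm_t01 : sgnperm t01 = mx3 0 (-1) 0 (-1) 0 0 0 0 (-1).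
Proof.
apply/matrixP => i j; rewrite /sgnperm odd_tperm expr1 !mxE permE /=.
by case: i j => [[|[|[|]]]] //= ? [[|[|[|]]]] //= ?; rewrite ?mulr1 ?mulr0.
Qed.

(* [ring] does not use [half2] to simplify a negative multiple of [half]. *)
Lemma half2N : -2 * Defs.half = -1.
Proof. by rewrite mulNr half2. Qed.

Ltac mx3_eq :=
  rewrite /mono /conjP /Pmx /omega ?sgnperm1 ?sgnperm_t02 ?sgnperm_t12
    ?sgnperm_t01 ?mulr1 ?diagz_tri ?mx3M ?mx3Z;
  congr mx3; ring: s2V_sqr half2N half2 z_exp9.

(** The exponents come from the eigenvalues on e1 + e3, e2 and e1 - e3, written as powers of z with
    -1 = z^9. *)
Lemma AmE : Am = mono (tri 8 14 14) 1.
Proof. by rewrite /Am; mx3_eq. Qed.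

Lemma BmE : Bm = mono (tri 6 12 0) 1.
Proof. by rewrite /Bm; mx3_eq. Qed.

Lemma G1E : G1 = mono (tri 16 4 16) t02.
Proof. by rewrite /G1; mx3_eq. Qed.

Lemma G2E : G2 = mono (tri 16 16 4) t01.
Proof. by rewrite /G2; mx3_eq. Qed.

Lemma FUME : FUM = mono (tri 15 15 6) 1.
Proof. by rewrite /FUM /Jm; mx3_eq. Qed.

Lemma H0E : H0 = mono (fun=> 0%N) t02.
Proof. by rewrite /H0 /mono diagz0 mul1r; mx3_eq. Qed.

Lemma H1E : H1 = mono (fun=> 0%N) t12.
Proof. by rewrite /H1 /mono diagz0 mul1r; mx3_eq. Qed.

Lemma H2E : H2 = H0 * H1 * H0.
Proof. by rewrite /H0 /H1 /H2; mx3_eq. Qed.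

Lemma H3E : H3 = H1 * H0.
Proof. by rewrite /H0 /H1 /H3; mx3_eq. Qed.

Lemma H4E : H4 = H0 * H1.
Proof. by rewrite /H0 /H1 /H4; mx3_eq. Qed.

(** * Fr(162x4), Fr(162) and their subgroups *)

Lemma ord3P (P : 'I_3 -> Prop) : P 0 -> P 1 -> P 2 -> forall i, P i.
Proof.
move=> P0 P1 P2; case=> [[|[|[|//]]] lti].
- by rewrite (_ : Ordinal lti = 0) //; apply: val_inj.
- by rewrite (_ : Ordinal lti = 1) //; apply: val_inj.
- by rewrite (_ : Ordinal lti = 2) //; apply: val_inj.
Qed.

Lemma mono1_eq (e e' : 'I_3 -> nat) :
  e 0 = e' 0 %[mod 18] -> e 1 = e' 1 %[mod 18] -> e 2 = e' 2 %[mod 18] ->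
  mono e 1 = mono e' 1.
Proof. by move=> ???; apply/mono_eqP; split=> //; apply: ord3P. Qed.

Definition Hs (s : 'S_3) : Mx := mono (fun=> 0%N) s.

Lemma HsM s t : Hs (s * t)%g = Hs s * Hs t.
Proof. by rewrite /Hs monoM. Qed.

Lemma Hs1 : Hs 1 = 1. Proof. exact: mono1. Qed.

Lemma Hs_inj : injective Hs.
Proof. by move=> s t /mono_eqP[]. Qed.

Lemma HsV s : (Hs s)^-1 = Hs s^-1.
Proof. by apply: mulmx1_invr; rewrite -HsM mulgV Hs1. Qed.

Lemma mono_split e s : mono e s = mono e 1 * Hs s.
Proof. by rewrite /Hs monoM mul1g; apply/mono_eqP; split=> // i; rewrite addn0. Qed.

(** The order is that of [Hlist], with [t02] for [H0] and [t12] for [H1]. *)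
Definition S3list : seq 'S_3 :=
  [:: 1; t02; t12; t02 * t12 * t02; t12 * t02; t02 * t12]%g.

(** The six words differ already in their images of 0 and 1, and S_3 has six elements. *)
Lemma mem_S3list s : s \in S3list.
Proof.
have uS : uniq S3list.
  apply: (@map_uniq _ _ (fun s : 'S_3 => (val (s 0), val (s 1)))).
  by rewrite /= !permM !permE.
have [|_ ->] := uniq_min_size uS (s2 := enum 'S_3) (fun x _ => mem_enum _ x).
  by rewrite -cardE card_Sn.
by rewrite mem_enum.
Qed.

Lemma Hlist_S3list : Hlist = map Hs S3list.
Proof. by rewrite /= !HsM Hs1 /Hlist H2E H3E H4E H0E H1E. Qed.

Lemma HlistP M : M \in Hlist <-> exists s, Hs s = M.
Proof.
rewrite Hlist_S3list; split=> [/mapP[s _ ->]|[s <-]]; first by exists s.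
by rewrite map_f ?mem_S3list.
Qed.

Lemma V2E : V2 = mono (tri 9 9 0) 1.
Proof. by rewrite /V2 FUME monoX; apply: mono1_eq. Qed.

Lemma V3E : V3 = mono (tri 0 9 9) 1.
Proof.
rewrite /V3 -/V2 V2E.
(* Checking V3 G1 = G1 V2 instead avoids the inverse; the transposition [t02] exchanges the outer
   exponents. *)
rewrite (_ : G1 * _ = mono (tri 0 9 9) 1 * G1) ?mulrK // G1E ?mono_unit //.
rewrite !monoM mulg1 mul1g; apply/mono_eqP; split=> //.
by apply: ord3P; rewrite !permE.
Qed.

Lemma C18E : C18 = mono (tri 17 5 14) 1.
Proof. by rewrite /C18 -/V2 V2E AmE monoM mulg1; apply: mono1_eq; rewrite perm1. Qed.

Lemma C6E : C6 = mono (tri 6 3 9) 1.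
Proof. by rewrite /C6 -/V3 V3E BmE monoM mulg1; apply: mono1_eq; rewrite perm1. Qed.

Lemma AB_E i j : Am ^+ i * Bm ^+ j =
  mono (tri (8 * i + 6 * j) (14 * i + 12 * j) (14 * i)) 1.
Proof.
rewrite AmE BmE !monoX monoM mulg1.
by apply: mono1_eq; rewrite perm1 /tri /=; congr modn; lia.
Qed.

Lemma CC_E i j : C18 ^+ i * C6 ^+ j =
  mono (tri (17 * i + 6 * j) (5 * i + 3 * j) (14 * i + 9 * j)) 1.
Proof.
rewrite C18E C6E !monoX monoM mulg1.
by apply: mono1_eq; rewrite perm1 /tri /=; congr modn; lia.
Qed.

(** In the new basis V consists of the diagonal sign matrices of determinant 1: as z^9 = -1, a and b
    give the outer signs and the middle one is their product. *)
Lemma VlistP T : T \in Vlist <->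
  exists a b : 'I_2, T = mono (tri (9 * a) (9 * a + 9 * b) (9 * b)) 1.
Proof.
have V4E : V4 = mono (tri 9 18 9) 1.
  by rewrite /V4 V2E V3E monoM mulg1; apply: mono1_eq; rewrite perm1.
rewrite !inE V4E V2E V3E -mono1; split.
  case/or4P=> /eqP ->.
  - by exists 0, 0; apply: mono1_eq.
  - by exists 1, 0; apply: mono1_eq.
  - by exists 0, 1; apply: mono1_eq.
  - by exists 1, 1; apply: mono1_eq.
case=> [[[|[|//]] ?] [[[|[|//]] ?] ->]]; apply/or4P.
- by apply: Or41; apply/eqP/mono1_eq.
- by apply: Or43; apply/eqP/mono1_eq.
- by apply: Or42; apply/eqP/mono1_eq.
- by apply: Or44; apply/eqP/mono1_eq.
Qed.

(** * Monomial descriptions of Fr(162x4) and Fr(162) *)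

Lemma gen_exp S M n : gen S M -> gen S (M ^+ n).
Proof.
by move=> SM; elim: n => [|n IHn]; [exact: gen_one | rewrite exprS; exact: gen_mul].
Qed.

Lemma gen_sub S S' M : {in S, forall X, gen S' X} -> gen S M -> gen S' M.
Proof.
move=> sub; elim=> [X /sub //||X Y _ SX _ SY|X _ SX].
- exact: gen_one.
- exact: gen_mul.
- exact: gen_inv.
Qed.

(* By [mono_det], the second condition says that the determinant is 1. *)
Definition det1_exp (e : 'I_3 -> nat) : Prop :=
  (forall i j, e i = e j %[mod 3])%N /\ (18 %| \sum_i e i)%N.

Lemma sum_ord3 (e : 'I_3 -> nat) : (\sum_i e i = e 0%R + e 1%R + e 2%R)%N.
Proof.
rewrite !big_ord_recl big_ord0 addn0 addnA.
by congr (e _ + e _ + e _)%N; apply: val_inj.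
Qed.

Lemma det1_expP (e : 'I_3 -> nat) : det1_exp e <->
  [/\ e 0 = e 1 %[mod 3], e 0 = e 2 %[mod 3]
    & (e 0%R + e 1%R + e 2%R)%N = 0%N %[mod 18]].
Proof.
rewrite /det1_exp sum_ord3 /dvdn; split=> [[eq /eqP ?] | [e01 e02 /eqP s18]] //.
by split=> //; apply: ord3P; apply: ord3P; rewrite -?e01 -?e02.
Qed.

Lemma det1_exp0 : det1_exp (fun=> 0%N).
Proof. exact/det1_expP. Qed.

Lemma det1_expD e e' : det1_exp e -> det1_exp e' -> det1_exp (fun i => e i + e' i)%N.
Proof.
by move=> /det1_expP[? ? ?] /det1_expP[? ? ?]; apply/det1_expP; split; lia.
Qed.

Lemma det1_exp_muln e n : det1_exp e -> det1_exp (fun i => n * e i)%N.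
Proof.
by move=> eP; elim: n => [|n IHn]; [exact: det1_exp0 | exact: det1_expD].
Qed.

Lemma det1_exp_perm e (s : 'S_3) : det1_exp e -> det1_exp (fun i => e (s i)).
Proof.
case=> eq3 e18; split=> //.
by move: e18; rewrite (reindex_inj (@perm_inj _ s)).
Qed.

Definition monomial_in (Q : ('I_3 -> nat) -> Prop) (M : Mx) : Prop :=
  exists e s, Q e /\ M = mono e s.

(** Closure under sums also yields inverses: modulo 18, the opposite of e is the sum of 17 copies of
    e. *)
Lemma gen_monomial_in (Q : ('I_3 -> nat) -> Prop) S M :
  Q (fun=> 0%N) -> (forall e e', Q e -> Q e' -> Q (fun i => e i + e' i)%N) ->
  (forall e (s : 'S_3), Q e -> Q (fun i => e (s i))) ->
  {in S, forall X, monomial_in Q X} -> gen S M -> monomial_in Q M.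
Proof.
move=> Q0 QD Qp SQ; elim=> [X /SQ //||X Y _ [e [s [Qe ->]]] _ [e' [s' [Qe' ->]]]|].
- by exists (fun=> 0%N), 1%g; rewrite mono1.
- exists (fun i => e i + e' (s i))%N, (s * s')%g; rewrite monoM.
  by split=> //; apply: QD => //; apply: (Qp e').
- move=> X _ [e [s [Qe ->]]]; exists (fun i => 17 * e (s^-1%g i))%N, s^-1%g.
  rewrite monoV; split=> //; elim: 17%N => [//|n IHn].
  by apply: (QD (fun i => e (s^-1%g i))) IHn; apply: Qp.
Qed.

Lemma gen_S3 S : gen S H0 -> gen S H1 -> forall s, gen S (Hs s).
Proof.
move=> SH0 SH1 s; have : Hs s \in Hlist by apply/HlistP; exists s.
rewrite !inE H2E H3E H4E.
by do 5?[case/predU1P => [->|]]; [exact: gen_one|..|move/eqP->]; do ?apply: gen_mul.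
Qed.

Lemma C_diagE e : det1_exp e ->
  exists (i : 'I_18) (j : 'I_6), mono e 1 = C18 ^+ i * C6 ^+ j.
Proof.
(* By [CC_E], modulo 18, -i + 6j = e 0 and 5i + 3j = e 1. So i = 6j - e 0 and 15j = 5 e 0 + e 1;
   division by 3 and 5 * 5 = 1 mod 6 give j. The third equation follows since the exponents sum to 0
   on both sides. *)
move=> /det1_expP[e01 e02 es]; pose j := ((25 * e 0%R + 5 * e 1%R) %/ 3)%N.
exists (inord ((6 * j + 17 * e 0%R) %% 18)), (inord (j %% 6)).
rewrite !inordK ?ltn_pmod // CC_E; apply: mono1_eq; rewrite /tri /=; lia.
Qed.

Lemma det1_exp_CC i j : det1_exp (tri (17 * i + 6 * j) (5 * i + 3 * j) (14 * i + 9 * j)).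
Proof. by apply/det1_expP; rewrite /tri /=; split; lia. Qed.

Lemma t02K : (t02 * t02 = 1)%g. Proof. exact: tperm2. Qed.
Lemma t12K : (t12 * t12 = 1)%g. Proof. exact: tperm2. Qed.
Lemma t01K : (t01 * t01 = 1)%g. Proof. exact: tperm2. Qed.

Lemma H0_H1H3 : H0 = H1 * H3.
Proof. by rewrite H3E mulrA H1E -HsM t12K Hs1 mul1r. Qed.

(** G1^8 = (G1^2)^4 is diagonal and cancels the diagonal part of [G1], leaving its permutation part.
    [H2_G2] works in the same way. *)
Lemma H0_G1 : H0 = G1 ^+ 9.
Proof.
rewrite (exprD G1 8 1) (exprM _ 2 4) expr2 expr1 G1E monoM t02K monoX monoM mul1g H0E.
by apply/mono_eqP; split=> //; apply: ord3P; rewrite !permE.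
Qed.

Lemma H2_G2 : H2 = G2 ^+ 9.
Proof.
rewrite (exprD G2 8 1) (exprM _ 2 4) expr2 expr1 G2E monoM t01K monoX monoM mul1g.
rewrite H2E H0E H1E -!HsM; apply/mono_eqP; split.
  by apply: ord3P; rewrite !permE.
by apply/permP; apply: ord3P; rewrite !permM !permE.
Qed.

Lemma H1_H02 : H1 = H0 * H2 * H0.
Proof.
by rewrite H2E !mulrA H0E -HsM t02K Hs1 mul1r -mulrA -HsM t02K Hs1 mulr1.
Qed.

Lemma Am_G : Am = G1 * G2 ^+ 2 * G1^-1.
Proof.
apply: (mulIr (mono_unit (tri 16 4 16) t02)).
rewrite -G1E mulrVK; last by rewrite G1E mono_unit.
rewrite expr2 AmE G1E G2E !monoM t01K mulg1 mul1g.
by apply/mono_eqP; split=> //; apply: ord3P; rewrite !permE.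
Qed.

Lemma Bm_G : Bm = G1 * (G2 ^+ 2)^-1 * G1.
Proof.
rewrite expr2 BmE G1E G2E !monoM t01K monoV invg1 !monoM mulg1 t02K.
by apply/mono_eqP; split=> //; apply: ord3P; rewrite !permE.
Qed.

Lemma gen_G_H0 S : gen S G1 -> gen S H0.
Proof. by rewrite H0_G1; apply: gen_exp. Qed.

Lemma gen_G_H1 S : gen S G1 -> gen S G2 -> gen S H1.
Proof.
move=> SG1 SG2; have SH0 := gen_G_H0 SG1.
by rewrite H1_H02 H2_G2; do !apply: gen_mul => //; apply: gen_exp.
Qed.

Lemma gen_G_Am S : gen S G1 -> gen S G2 -> gen S Am.
Proof.
by move=> SG1 SG2; rewrite Am_G; do !apply: gen_mul => //; apply: gen_inv.
Qed.

Lemma gen_G_Bm S : gen S G1 -> gen S G2 -> gen S Bm.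
Proof.
by move=> SG1 SG2; rewrite Bm_G; do !apply: gen_mul => //; apply: gen_inv; apply: gen_exp.
Qed.

(** This opens a cycle of three inclusions, from [Fr648] to the monomial matrices, to the group
    generated by [C6], [C18], [H1], [H3], and back. It yields both [Fr648P] and the generation claim
    of (c). *)
Lemma Fr648_monomial_in M : Fr648 M -> monomial_in det1_exp M.
Proof.
apply: gen_monomial_in; [exact: det1_exp0|exact: det1_expD|exact: det1_exp_perm|].
move=> X; rewrite !inE G1E G2E FUME => /or3P[]/eqP->;
  by do 2 eexists; split; last reflexivity; apply/det1_expP.
Qed.

Lemma monomial_in_gen_C M : monomial_in det1_exp M -> gen [:: C6; C18; H1; H3] M.
Proof.
case=> e [s [ade ->]]; rewrite mono_split; have [i [j ->]] := C_diagE ade.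
have SH1 : gen [:: C6; C18; H1; H3] H1 by apply: gen_base; rewrite !inE eqxx !orbT.
have SH3 : gen [:: C6; C18; H1; H3] H3 by apply: gen_base; rewrite !inE eqxx !orbT.
apply: gen_mul; last by apply: gen_S3 => //; rewrite H0_H1H3; apply: gen_mul.
by apply: gen_mul; apply: gen_exp; apply: gen_base; rewrite !inE eqxx ?orbT.
Qed.

Lemma Fr648_gen_C M : gen [:: C6; C18; H1; H3] M -> Fr648 M.
Proof.
have S1 : Fr648 G1 by apply: gen_base; rewrite !inE eqxx.
have S2 : Fr648 G2 by apply: gen_base; rewrite !inE eqxx orbT.
have SF : Fr648 FUM by apply: gen_base; rewrite !inE eqxx !orbT.
have SV := gen_exp 3 SF.
have SH1 := gen_G_H1 S1 S2.
have SH0 := gen_G_H0 S1.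
apply: gen_sub => X; rewrite !inE.
case/or4P => /eqP -> //.
- apply: gen_mul; first exact: gen_G_Bm.
  by apply: gen_mul; [exact: gen_mul | exact: gen_inv].
- by apply: gen_mul => //; apply: gen_G_Am.
- by rewrite H3E; apply: gen_mul.
Qed.

Lemma Fr648P M : Fr648 M <-> monomial_in det1_exp M.
Proof.
by split=> [/Fr648_monomial_in // | /monomial_in_gen_C/Fr648_gen_C].
Qed.

Definition even_det1_exp e := det1_exp e /\ forall i : 'I_3, ~~ odd (e i).

Lemma AB_diagE e : even_det1_exp e ->
  exists (i : 'I_9) (j : 'I_3), mono e 1 = Am ^+ i * Bm ^+ j.
Proof.
move=> [/det1_expP[e01 e02 es] ev]; have := ev 0; have := ev 1; have := ev 2.
move=> ev2 ev1 ev0.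
(* By [AB_E], 14i = e 2 mod 18; halving and using 7 * 4 = 1 mod 9 gives i = 2 e 2. Then 6j = e 0 -
   8i = e 0 + 2 e 2 mod 18, and the sum condition settles the middle exponent. *)
exists (inord ((2 * e 2%R) %% 9)), (inord ((e 0%R + 2 * e 2%R) %/ 6 %% 3)).
rewrite !inordK ?ltn_pmod // AB_E; apply: mono1_eq; rewrite /tri /=; lia.
Qed.

Lemma Fr162P M : Fr162 M <-> monomial_in even_det1_exp M.
Proof.
split.
  apply: gen_monomial_in.
  - by split; [exact: det1_exp0|].
  - move=> e e' [? ev] [? ev']; split; first exact: det1_expD.
    by move=> i; rewrite oddD (negPf (ev i)) ev'.
  - by move=> e s [? ?]; split; [exact: det1_exp_perm |].
  move=> X; rewrite !inE G1E G2E => /orP[]/eqP->.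
  - by exists (tri 16 4 16), t02; split=> //; split; [apply/det1_expP | apply: ord3P].
  - by exists (tri 16 16 4), t01; split=> //; split; [apply/det1_expP | apply: ord3P].
case=> e [s [ade ->]]; rewrite mono_split; have [i [j ->]] := AB_diagE ade.
have S1 : Fr162 G1 by apply: gen_base; rewrite !inE eqxx.
have S2 : Fr162 G2 by apply: gen_base; rewrite !inE eqxx orbT.
apply: gen_mul; last by apply: gen_S3; [exact: gen_G_H0 | exact: gen_G_H1].
by apply: gen_mul; apply: gen_exp; [exact: gen_G_Am|exact: gen_G_Bm].
Qed.

(** * Unitarity and determinant *)

Lemma adjM_M X Y : adjM (X * Y) = adjM Y * adjM X.
Proof. by rewrite /adjM -!mulmxE map_mxM trmx_mul. Qed.

Lemma adjM_Pmx : adjM Pmx = Pmx.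
Proof.
have rc : r^* = r by apply/conj_Creal; rewrite ger0_real // invr_ge0 sqrtC_ge0 ler0n.
apply/matrixP => i j; rewrite !mxE.
by case: i j => [[|[|[|]]]] //= ? [[|[|[|]]]] //= ?;
  rewrite ?rmorphN /= ?rmorph0 ?rmorph1 ?rc.
Qed.

Lemma mono_unitary e s : mono e s * adjM (mono e s) = 1.
Proof.
have zz n : z ^+ n * (z ^+ n)^* = 1.
  by rewrite -normCK normrX (@norm1_of_exp z 9) ?z_exp9 ?normrN1 ?expr1n.
have dd : diagz e * adjM (diagz e) = 1.
  apply/matrixP => i j; rewrite -mulmxE mul_diag_mx !mxE eq_sym.
  by case: eqP => [->|_]; rewrite ?zz // rmorph0 mulr0.
have ss : sgnperm s * adjM (sgnperm s) = 1.
  have -> : adjM (sgnperm s) = sgnperm s^-1.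
    apply/matrixP => i j; rewrite !mxE odd_permV rmorphM rmorph_sign /= rmorph_nat.
    by rewrite (canF_eq (permKV s)) eq_sym.
  by rewrite -sgnpermM mulgV sgnperm1.
rewrite /mono /conjP !adjM_M adjM_Pmx.
rewrite !mulrA -[_ * Pmx * Pmx]mulrA PmxK mulr1.
rewrite -[_ * sgnperm s * adjM _]mulrA ss mulr1.
by rewrite -[_ * diagz e * adjM _]mulrA dd mulr1 PmxK.
Qed.

Lemma mono_det e s : det1_exp e -> \det (mono e s) = 1.
Proof.
have det_conjP X : \det (conjP X) = \det X.
  rewrite /conjP -!mulmxE !det_mulmx mulrAC -det_mulmx.
  by rewrite mulmxE PmxK det1 mul1r.
move=> [_ e18]; rewrite /mono det_conjP -mulmxE det_mulmx.
(* The scalar sign contributes its cube and the permutation matrix one more sign, so the fourth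
   power is 1. *)
rewrite det_diag detZ det_perm -exprSr -exprM.
rewrite (eq_bigr (fun i => z ^+ e i)) => [|i _]; last by rewrite mxE.
rewrite -expr_sum; case/dvdnP: e18 => k ->.
rewrite mulnC exprM (prim_expr_order z_prim) expr1n mul1r.
by rewrite exprM (exprM _ 2 2) sqrr_sign expr1n.
Qed.

(** * The isomorphism of Fr(162) with D(9,1,1;2,1,1) *)

Lemma conjPV X : conjP X^-1 = (conjP X)^-1.
Proof.
have [uX|nuX] := boolP (X \is a GRing.unit).
  by apply/esym/mulmx1_invr; rewrite -conjPM mulrV // conjP1.
(* [gen] admits the inverse of any matrix; a non-invertible one is its own [^-1] by convention, so
   it remains to see that [conjP X] is not invertible either. *)
rewrite !invr_out //; apply: contra nuX => ucX.
have [] // := @mulmx1_unit _ _ X (conjP (conjP X)^-1).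
by rewrite mulmxE -[X in X * _]conjPK -conjPM mulrV // conjP1.
Qed.

Lemma gen_conjP S S' M :
  {in S, forall X, gen S' (conjP X)} -> gen S M -> gen S' (conjP M).
Proof.
move=> sub; elim=> [X /sub //||X Y _ SX _ SY|X _ SX].
- by rewrite conjP1; apply: gen_one.
- by rewrite conjPM; apply: gen_mul.
- by rewrite conjPV; apply: gen_inv.
Qed.

Lemma Dg1E : Dg1 = diagz (tri 2 2 14).
Proof.
rewrite diagz_tri /Dg1 (_ : z ^- 4 = z ^+ 14) //.
apply: (mulfI (expf_neq0 4 z_neq0)).
by rewrite mulfV ?expf_neq0 ?z_neq0 // -exprD prim_expr_order ?z_prim.
Qed.

Lemma BtilE : Btil = sgnperm t12.
Proof. by rewrite sgnperm_t12. Qed.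

Lemma EmE : Em = sgnperm (t02 * t12)%g.
Proof. by rewrite sgnpermM sgnperm_t02 sgnperm_t12 mx3M /Em; congr mx3; ring. Qed.

Lemma conjP_Fr162_Dgrp M : Fr162 M -> Dgrp (conjP M).
Proof.
have DD : Dgrp (diagz (tri 2 2 14)) by rewrite -Dg1E; apply: gen_base; rewrite !inE eqxx.
have DE : Dgrp Em by apply: gen_base; rewrite !inE eqxx orbT.
have D12 : Dgrp (sgnperm t12) by rewrite -BtilE; apply: gen_base; rewrite !inE eqxx !orbT.
have D02 : Dgrp (sgnperm t02).
  rewrite -[t02]mulg1 -t12K mulgA sgnpermM -EmE; exact: gen_mul.
apply: gen_conjP => X; rewrite !inE => /orP[]/eqP->.
  rewrite G1E /mono conjPK; apply: gen_mul => //.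
  (* Modulo 18, 8 (2, 2, 14) = (16, 16, 4), the exponents of [G2]; exchanging the last two gives
     those of [G1]. *)
  rewrite (_ : diagz _ = sgnperm t12 * diagz (tri 2 2 14) ^+ 8 * sgnperm t12).
    by apply: gen_mul => //; apply: gen_mul => //; apply: gen_exp.
  rewrite diagzX sgnperm_diagz -mulrA -sgnpermM t12K sgnperm1 mulr1; apply/diagz_eqP.
  by apply: ord3P; rewrite /= !permE.
rewrite G2E /mono conjPK; apply: gen_mul.
  rewrite (_ : diagz _ = diagz (tri 2 2 14) ^+ 8); first exact: gen_exp.
  by rewrite diagzX; apply/diagz_eqP; apply: ord3P.
rewrite (_ : t01 = t02 * t12 * t02)%g; first by rewrite !sgnpermM; do !apply: gen_mul.
by apply/permP; apply: ord3P; rewrite !permM !permE.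
Qed.

Lemma conjP_Dgrp_Fr162 M : Dgrp M -> Fr162 (conjP M).
Proof.
have H s : Fr162 (conjP (sgnperm s)).
  rewrite -[sgnperm s]mul1r -diagz0; apply/Fr162P; exists (fun=> 0%N), s; split=> //.
  by split; [exact: det1_exp0|].
apply: gen_conjP => X; rewrite !inE => /or3P[]/eqP->.
- apply/Fr162P; exists (tri 2 2 14), 1%g.
  rewrite /mono sgnperm1 mulr1 Dg1E; split=> //; split; [exact/det1_expP | exact: ord3P].
- by rewrite EmE; apply: H.
- by rewrite BtilE; apply: H.
Qed.

(** * Unique exponents and group orders *)

Lemma AB_inj i i' j j' s s' : (i < 9)%N -> (i' < 9)%N -> (j < 3)%N -> (j' < 3)%N ->
  Am ^+ i * Bm ^+ j * Hs s = Am ^+ i' * Bm ^+ j' * Hs s' -> [/\ i = i', j = j' & s = s'].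
Proof.
move=> li li' lj lj'; rewrite !AB_E -!mono_split => /mono_eqP[eq ->].
have := eq 0; have := eq 2; rewrite /tri /= => *; split=> //; lia.
Qed.

Lemma CC_inj i i' j j' s s' :
  C18 ^+ i * C6 ^+ j * Hs s = C18 ^+ i' * C6 ^+ j' * Hs s' ->
  [/\ i = i' %[mod 18], j = j' %[mod 6] & s = s'].
Proof.
rewrite !CC_E -!mono_split => /mono_eqP[eq ->].
have := eq 0; have := eq 1; have := eq 2; rewrite /tri /= => *; split=> //; lia.
Qed.

Lemma order_image (P : Mx -> Prop) (I : finType) (f : I -> Mx) :
  injective f -> (forall M, P M <-> exists x, f x = M) -> has_order P #|I|.
Proof.
move=> finj Pf; exists (map f (enum I)).
rewrite map_inj_uniq // enum_uniq size_map -cardE.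
split=> //; split=> // M; rewrite Pf; split=> [[x <-]|/mapP[x _ ->]]; last by exists x.
by rewrite map_f ?mem_enum.
Qed.

Lemma Fr162_order : has_order Fr162 162.
Proof.
have -> : 162%N = #|{: 'I_9 * 'I_3 * 'S_3}| by rewrite !card_prod !card_ord card_Sn.
pose f (x : 'I_9 * 'I_3 * 'S_3) := Am ^+ x.1.1 * Bm ^+ x.1.2 * Hs x.2.
apply: (@order_image _ _ f) => [[[i j] s] [[i' j'] s']|M].
  by case/AB_inj => //= /val_inj -> /val_inj -> ->.
split=> [/Fr162P[e [s [ade ->]]] | [[[i j] s] <-]].
  by rewrite mono_split; have [i [j ->]] := AB_diagE ade; exists (i, j, s).
rewrite /f AB_E -mono_split; apply/Fr162P; do 2 eexists; split; last reflexivity.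
split; [apply/det1_expP | apply: ord3P]; rewrite /tri /=; try split; lia.
Qed.

Lemma Fr648_order : has_order Fr648 648.
Proof.
have -> : 648%N = #|{: 'I_18 * 'I_6 * 'S_3}| by rewrite !card_prod !card_ord card_Sn.
pose f (x : 'I_18 * 'I_6 * 'S_3) := C18 ^+ x.1.1 * C6 ^+ x.1.2 * Hs x.2.
apply: (@order_image _ _ f) => [[[i j] s] [[i' j'] s']|M].
  case/CC_inj => //=; rewrite !modn_small // => /val_inj -> /val_inj -> -> //.
split=> [/Fr648P[e [s [ade ->]]] | [[[i j] s] <-]].
  by rewrite mono_split; have [i [j ->]] := C_diagE ade; exists (i, j, s).
rewrite /f CC_E -mono_split; apply/Fr648P; do 2 eexists; split; last reflexivity.
exact: det1_exp_CC.
Qed.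

(** * The normal subgroup NV, its complement H and the normal form *)

Lemma mono_diagM e e' : mono e 1 * mono e' 1 = mono (fun i => e i + e' i)%N 1.
Proof. by rewrite monoM mulg1; apply: mono1_eq; rewrite perm1. Qed.

Lemma NgrpP M : Ngrp M <-> exists2 e, even_det1_exp e & M = mono e 1.
Proof.
split=> [|[e ade ->]]; last first.
  have [i [j ->]] := AB_diagE ade.
  by apply: gen_mul; apply: gen_exp; apply: gen_base; rewrite !inE eqxx ?orbT.
elim=> [X|||X _ [e [ade ev] ->]].
- rewrite !inE AmE BmE => /orP[]/eqP->.
    by exists (tri 8 14 14) => //; split; [apply/det1_expP | apply: ord3P].
  by exists (tri 6 12 0) => //; split; [apply/det1_expP | apply: ord3P].
- by exists (fun=> 0%N); [split; [exact: det1_exp0|] | rewrite mono1].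
- move=> X Y _ [e [ade ev] ->] _ [e' [ade' ev'] ->]; rewrite mono_diagM.
  eexists; last reflexivity; split; first exact: det1_expD.
  by move=> i; rewrite oddD (negPf (ev i)) ev'.
- exists (fun i => 17 * e i)%N.
    by split=> [|i]; [exact: det1_exp_muln | rewrite oddM /= ev].
  by rewrite monoV invg1; apply: mono1_eq; rewrite perm1.
Qed.

Lemma NVP M : NV M <-> exists2 e, det1_exp e & M = mono e 1.
Proof.
split=> [[N [T [/NgrpP[e [ade _] ->] [/VlistP[a [b ->]] ->]]]] | [e ade ->]].
  rewrite mono_diagM; eexists; last reflexivity; apply: det1_expD => //.
  by apply/det1_expP; rewrite /tri /=; split; lia.
(* 10 e + 9 e = e mod 18, where 10 e is even and 9 e only depends on e mod 2. *)
exists (mono (fun i => 10 * e i)%N 1), (mono (fun i => 9 * e i)%N 1).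
split; last split.
- apply/NgrpP; eexists; last reflexivity.
  by split=> [|i]; [exact: det1_exp_muln | rewrite oddM].
(* The exponents have even sum, so the middle parity is the sum of the outer ones, as [VlistP]
   requires. *)
- have [_ _ es] := (det1_expP _).1 ade.
  apply/VlistP; exists (inord (e 0%R %% 2)), (inord (e 2%R %% 2)).
  by rewrite !inordK ?ltn_pmod //; apply: mono1_eq; rewrite /tri /=; lia.
- by rewrite mono_diagM; apply: mono1_eq; lia.
Qed.

Lemma NV_subgroup : [/\ NV 1, (forall M N, NV M -> NV N -> NV (M * N)),
      (forall M, NV M -> NV M^-1),
      (forall M, NV M -> Fr648 M)
    & (forall g M, Fr648 g -> NV M -> NV (g * M * g^-1))].
Proof.
split.
- by apply/NVP; exists (fun=> 0%N); [exact: det1_exp0 | rewrite mono1].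
- move=> M N /NVP[e ade ->] /NVP[e' ade' ->]; apply/NVP.
  by rewrite mono_diagM; eexists; last reflexivity; exact: det1_expD.
- move=> M /NVP[e ade ->]; apply/NVP; exists (fun i => 17 * e i)%N.
    exact: det1_exp_muln.
  by rewrite monoV invg1; apply: mono1_eq; rewrite perm1.
- by move=> M /NVP[e ade ->]; apply/Fr648P; exists e, 1%g.
move=> g M /Fr648P[e [s [ade ->]]] /NVP[e' ade' ->]; apply/NVP.
exists (fun i => e' (s i)); first exact: det1_exp_perm.
(* Conjugation by [mono e s] only permutes the exponents, as diagonal matrices commute. *)
rewrite (_ : mono e s * mono e' 1 = mono (fun i => e' (s i)) 1 * mono e s).
  by rewrite mulrK ?mono_unit.
rewrite !monoM mulg1 mul1g; apply/mono_eqP; split=> // i.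
by rewrite perm1 addnC.
Qed.

Lemma N_V_commute N T : Ngrp N -> T \in Vlist -> N * T = T * N.
Proof.
move=> /NgrpP[e _ ->] /VlistP[a [b ->]]; rewrite !mono_diagM.
by apply: mono1_eq; rewrite addnC.
Qed.

(** Exponents are even in N and multiples of 9 in V, hence 0 modulo 18 in both. *)
Lemma N_V_trivial M : Ngrp M -> M \in Vlist -> M = 1.
Proof.
move=> /NgrpP[e [_ ev] ->] /VlistP[a [b /mono_eqP[eq _]]]; rewrite -mono1.
have := (eq 0, eq 2, (ev 0, ev 2)); have := eq 1; rewrite /tri /=.
move=> e1 [[e0 e2] [ev0 ev2]]; apply: mono1_eq; lia.
Qed.

Lemma NV_Z18xZ6 : exists f : 'Z_18 * 'Z_6 -> Mx,
     [/\ injective f, (forall M, NV M <-> exists x, f x = M)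
       & forall a b c d, f (a + c, b + d) = f (a, b) * f (c, d)].
Proof.
exists (fun x : 'Z_18 * 'Z_6 => C18 ^+ x.1 * C6 ^+ x.2); split.
- move=> [i j] [i' j'] /= eq.
  have /CC_inj[] : C18 ^+ i * C6 ^+ j * Hs 1 = C18 ^+ i' * C6 ^+ j' * Hs 1 by rewrite eq.
  by rewrite !modn_small ?ltn_ord // => /val_inj -> /val_inj ->.
- move=> M; split=> [/NVP[e ade ->]|[[i j] <-]].
    by have [i [j ->]] := C_diagE ade; exists (i, j).
  by apply/NVP; rewrite CC_E; eexists; last reflexivity; exact: det1_exp_CC.
- move=> a b c d; rewrite !CC_E mono_diagM.
  have ac : nat_of_ord (a + c)%R = ((a + c) %% 18)%N by [].
  have bd : nat_of_ord (b + d)%R = ((b + d) %% 6)%N by [].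
  rewrite [fst _]/= [snd _]/= ac bd => {ac bd}.
  move: (nat_of_ord a) (nat_of_ord b) (nat_of_ord c) (nat_of_ord d) => a' b' c' d'.
  by apply: mono1_eq; rewrite /tri /=; lia.
Qed.

Lemma Hlist_mul M N : M \in Hlist -> N \in Hlist -> M * N \in Hlist.
Proof.
by move=> /HlistP[s <-] /HlistP[t <-]; apply/HlistP; exists (s * t)%g; rewrite HsM.
Qed.

Lemma Hlist_inv M : M \in Hlist -> M^-1 \in Hlist.
Proof. by move=> /HlistP[s <-]; apply/HlistP; exists s^-1%g; rewrite HsV. Qed.

Lemma NV_H_trivial M : NV M -> M \in Hlist -> M = 1.
Proof.
move=> /NVP[e _ ->] /HlistP[s /mono_eqP[eq _]].
by rewrite -mono1; apply: mono1_eq; rewrite -eq.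
Qed.

Lemma Fr648_NV_H M : Fr648 M <-> exists X Y, NV X /\ Y \in Hlist /\ M = X * Y.
Proof.
split=> [/Fr648P[e [s [ade ->]]] | [X [Y [/NVP[e ade ->] [/HlistP[s <-] ->]]]]].
  exists (mono e 1), (Hs s); rewrite (mono_split e s); split; last split=> //.
    by apply/NVP; exists e.
  by apply/HlistP; exists s.
by rewrite -mono_split; apply/Fr648P; exists e, s.
Qed.

Lemma Fr648_normal_form M : Fr648 M <->
     exists (i : 'I_9) (j : 'I_3) T Hm,
       [/\ T \in Vlist, Hm \in Hlist & M = Am ^+ i * Bm ^+ j * T * Hm].
Proof.
rewrite Fr648_NV_H; split.
  move=> [_ [Y [[N [T [/NgrpP[e ade ->] [VT ->]]]] [HY ->]]]].
  by have [i [j ->]] := AB_diagE ade; exists i, j, T, Y.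
move=> [i [j [T [Y [VT HY ->]]]]]; exists (Am ^+ i * Bm ^+ j * T), Y; split=> //.
exists (Am ^+ i * Bm ^+ j), T; split=> //.
by apply: gen_mul; apply: gen_exp; apply: gen_base; rewrite !inE eqxx ?orbT.
Qed.

Lemma Fr648_normal_form_uniq (i i' : 'I_9) (j j' : 'I_3) T T' Hm Hm' :
     T \in Vlist -> T' \in Vlist -> Hm \in Hlist -> Hm' \in Hlist ->
     Am ^+ i * Bm ^+ j * T * Hm = Am ^+ i' * Bm ^+ j' * T' * Hm' ->
     [/\ i = i', j = j', T = T' & Hm = Hm'].
Proof.
move=> /VlistP[a [b ->]] /VlistP[a' [b' ->]] /HlistP[s <-] /HlistP[s' <-].
rewrite !AB_E !mono_diagM -!mono_split => /mono_eqP[eq ->].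
have := ltn_ord i; have := ltn_ord i'; have := ltn_ord j; have := ltn_ord j'.
have := ltn_ord a; have := ltn_ord a'; have := ltn_ord b; have := ltn_ord b'.
have := eq 0; have := eq 1; have := eq 2; rewrite /tri /= => e2 e1 e0 *.
(* The third exponent 14i + 9b gives b by parity, then i modulo 9; the first, 8i + 6j + 9a, gives a
   by parity, then j modulo 3. *)
have bb' : b = b' :> nat by lia.
have ii' : i = i' :> nat by lia.
have aa' : a = a' :> nat by lia.
have jj' : j = j' :> nat by lia.
by rewrite aa' bb'; split=> //; apply: val_inj.
Qed.

(** * The presentation *)

Section Presentation.
Variables (T : Type) (mul : T -> T -> T) (one : T).
Local Notation "x ** y" := (mul x y) (at level 40, left associativity).
Local Notation pw := (gpow mul one).
Hypothesis mulA : forall x y w, x ** (y ** w) = x ** y ** w.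
Hypotheses (mul1x : forall x, one ** x = x) (mulx1 : forall x, x ** one = x).

Lemma gpowS x n : pw x n.+1 = x ** pw x n. Proof. by []. Qed.

Lemma gpowD x m n : pw x (m + n) = pw x m ** pw x n.
Proof. by elim: m => [|m IHm] /=; rewrite ?mul1x // IHm mulA. Qed.

Lemma gpow_intertwine h x y n : h ** x = y ** h -> h ** pw x n = pw y n ** h.
Proof.
move=> hx; elim: n => [|n IHn] /=; first by rewrite mulx1 mul1x.
by rewrite mulA hx -mulA IHn mulA.
Qed.

Lemma gpow_mulC x y n : x ** y = y ** x -> pw (x ** y) n = pw x n ** pw y n.
Proof.
move=> xy; elim: n => [|n IHn] /=; first by rewrite mulx1.
by rewrite IHn !mulA -!(mulA x) (gpow_intertwine n (esym xy)) !mulA.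
Qed.

Lemma gpowM x m n : pw x (m * n) = pw (pw x m) n.
Proof. by elim: n => [|n IHn]; rewrite ?muln0 // mulnS gpowD IHn. Qed.

Lemma gpow_modn x d m n : pw x d = one -> m = n %[mod d] -> pw x m = pw x n.
Proof.
have pw1 k : pw one k = one by elim: k => //= k ->.
move=> xd eq_mn.
by rewrite (divn_eq m d) (divn_eq n d) eq_mn !gpowD !(mulnC _ d) !gpowM xd !pw1.
Qed.

(* The relations of [pres_rels] without inverses, so that they make sense in the
   ring of matrices, which is only a monoid. *)
Record rewriting_rels (c6 c18 h1 h3 : T) : Prop := RewritingRels {
  c6_order : pw c6 6 = one;
  c18_order : pw c18 18 = one;
  h1_order : pw h1 2 = one;
  h3_order : pw h3 3 = one;
  c6c18 : c6 ** c18 = c18 ** c6;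
  h1c6 : h1 ** c6 = (pw c6 5 ** pw c18 6) ** h1;
  h1c18 : h1 ** c18 = (pw c6 3 ** c18) ** h1;
  h3c6 : h3 ** c6 = (c6 ** pw c18 15) ** h3;
  h3c18 : h3 ** c18 = (c6 ** pw c18 10) ** h3;
  h3h1 : h3 ** h1 = h1 ** pw h3 2 }.

Definition nform (c6 c18 h1 h3 : T) (i j a b : nat) : T :=
  pw c18 i ** pw c6 j ** (pw h1 a ** pw h3 b).

Section NormalForm.
Variables (c6 c18 h1 h3 : T).
Hypothesis rels : rewriting_rels c6 c18 h1 h3.
Local Notation g := (nform c6 c18 h1 h3).

Lemma nform_mod i j a b i' j' a' b' :
  i = i' %[mod 18] -> j = j' %[mod 6] -> a = a' %[mod 2] -> b = b' %[mod 3] ->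
  g i j a b = g i' j' a' b'.
Proof.
case: rels => r6 r18 r1 r3 _ _ _ _ _ _ ei ej ea eb; rewrite /nform.
by rewrite (gpow_modn r18 ei) (gpow_modn r6 ej) (gpow_modn r1 ea)
  (gpow_modn r3 eb).
Qed.

Lemma c6c18_pow m n : pw c6 m ** pw c18 n = pw c18 n ** pw c6 m.
Proof.
apply: gpow_intertwine; apply/esym/gpow_intertwine/esym; exact: (c6c18 rels).
Qed.

(** Left multiplication by a generator preserves normal forms and changes the exponents by formulas
    that are the same in every monoid satisfying the relations; [pres_mapM] rests on this. *)
Lemma mul_c18_nform i j a b : c18 ** g i j a b = g i.+1 j a b.
Proof. by rewrite /nform gpowS !mulA. Qed.

Lemma mul_c6_nform i j a b : c6 ** g i j a b = g i j.+1 a b.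
Proof.
by rewrite /nform gpowS !mulA (gpow_intertwine _ (c6c18 rels)).
Qed.

(** Moving h to the right acts linearly on the exponents (i, j), because [c6] and [c18] commute. *)
Lemma mul_act_nform h p q p' q' i j a b :
  h ** c18 = (pw c6 p ** pw c18 q) ** h -> h ** c6 = (pw c6 p' ** pw c18 q') ** h ->
  h ** g i j a b =
  pw c18 (q * i + q' * j) ** pw c6 (p * i + p' * j) ** (h ** (pw h1 a ** pw h3 b)).
Proof.
move=> hc18 hc6.
have -> : pw c18 (q * i + q' * j) ** pw c6 (p * i + p' * j) =
    pw (pw c6 p ** pw c18 q) i ** pw (pw c6 p' ** pw c18 q') j.
  have com := c6c18_pow.
  rewrite (gpow_mulC _ (com p q)) (gpow_mulC _ (com p' q')) -!gpowM !gpowD.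
  rewrite (com (p * i)%N) (com (p' * j)%N) -!mulA.
  by rewrite [in RHS](mulA _ _ (pw c6 _)) com -!mulA.
rewrite /nform !mulA (gpow_intertwine _ hc18) -(mulA _ h).
by rewrite (gpow_intertwine _ hc6) !mulA.
Qed.

Lemma mul_h1_nform i j a b : h1 ** g i j a b = g (i + 6 * j) (3 * i + 5 * j) a.+1 b.
Proof.
have hc18 : h1 ** c18 = (pw c6 3 ** pw c18 1) ** h1.
  by rewrite [pw c18 1]mulx1; exact: (h1c18 rels).
rewrite (mul_act_nform i j a b hc18 (h1c6 rels)).
by rewrite mul1n /nform gpowS !mulA.
Qed.

(** Each passage of [h1] doubles the exponent of [h3], by [h3h1]. *)
Lemma h3_h1_pow m a : pw h3 m ** pw h1 a = pw h1 a ** pw h3 (m * 2 ^ a).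
Proof.
elim: a m => [|a IHa] m; first by rewrite mulx1 mul1x muln1.
rewrite [pw h1 _]/= mulA.
have -> : pw h3 m ** h1 = h1 ** pw h3 (2 * m).
  rewrite gpowM; apply/esym/gpow_intertwine/esym; exact: (h3h1 rels).
by rewrite -!mulA IHa expnS mulnA (mulnC m).
Qed.

Lemma mul_h3_nform i j a b :
  h3 ** g i j a b = g (10 * i + 15 * j) (i + j) a (2 ^ a + b).
Proof.
have hc18 : h3 ** c18 = (pw c6 1 ** pw c18 10) ** h3.
  by rewrite [pw c6 1]mulx1; exact: (h3c18 rels).
have hc6 : h3 ** c6 = (pw c6 1 ** pw c18 15) ** h3.
  by rewrite [pw c6 1]mulx1; exact: (h3c6 rels).
rewrite (mul_act_nform i j a b hc18 hc6).
have := h3_h1_pow 1 a; rewrite [pw h3 1]/= mulx1 mul1n => h3h1a.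
by rewrite !mul1n /nform (mulA h3) h3h1a (gpowD h3) !mulA.
Qed.

End NormalForm.

Lemma pres_rels_rewriting inv c6 c18 h1 h3 : is_group mul one inv ->
  pres_rels mul one inv c6 c18 h1 h3 -> rewriting_rels c6 c18 h1 h3.
Proof.
case=> _ _ _ mulVx mulxV [r6 [r18 [rc [r1 [r3 [r13 [r16 [r118 [r36 r318]]]]]]]]].
have invE x y : x ** y = one -> inv x = y.
  by move=> xy; rewrite -[y]mul1x -(mulVx x) -mulA xy mulx1.
have mvr x y w : x ** inv y = w -> x = w ** y.
  by move=> <-; rewrite -mulA mulVx mulx1.
have inv6 : inv c6 = pw c6 5 by apply: invE.
have inv18 : inv (pw c18 3) = pw c18 15 by apply: invE; rewrite -gpowD.
have h3h1h3 : h3 ** h1 ** h3 = h1.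
  have h11 : h1 ** h1 = one by move: r1; rewrite /= mulx1.
  by rewrite -[RHS]mulx1 -r13 /= mulx1 !mulA h11 mul1x.
split=> //.
- by move: rc; rewrite mulA => /mvr; rewrite mul1x => /mvr.
- by rewrite -inv6; apply: mvr.
- exact: mvr.
- by rewrite -inv18; apply: mvr.
- exact: mvr.
(* h1 h3^2 = (h3 h1 h3) h3^2 = h3 h1 h3^3 = h3 h1. *)
- by rewrite -[in RHS]h3h1h3 -(mulA (h3 ** h1)) -(gpowS h3 2) r3 mulx1.
Qed.

End Presentation.

(** * The relations and the unique normal form in Fr(162x4) *)

Local Notation mulMx := (fun x y : Mx => x * y).

Lemma gpow_mx (X : Mx) n : gpow mulMx 1 X n = X ^+ n.
Proof. by elim: n => [|n IHn] //=; rewrite IHn exprS. Qed.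

Lemma H3_Hs : H3 = Hs (t12 * t02)%g.
Proof. by rewrite H3E H1E H0E -HsM. Qed.

Lemma HsX s n : Hs s ^+ n = Hs (s ^+ n)%g.
Proof.
by elim: n => [|n IHn]; rewrite ?expg0 ?Hs1 // exprS IHn -HsM -expgS.
Qed.

Lemma t12t02_cube : ((t12 * t02) ^+ 3 = 1)%g.
Proof.
by apply/permP; apply: ord3P; rewrite !expgS expg0 !permM !permE.
Qed.

Lemma mx_rewriting_rels : rewriting_rels mulMx 1 C6 C18 H1 H3.
Proof.
have C6X n : C6 ^+ n = mono (fun i => n * tri 6 3 9 i)%N 1 by rewrite C6E monoX.
have C18X n : C18 ^+ n = mono (fun i => n * tri 17 5 14 i)%N 1 by rewrite C18E monoX.
have swap (h : 'S_3) e e' : (forall i, e (h i) = e' i %[mod 18])%N ->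
    Hs h * mono e 1 = mono e' 1 * Hs h.
  move=> ee'; rewrite !monoM mulg1 mul1g; apply/mono_eqP; split=> // i.
  by rewrite addn0 add0n ee'.
split; rewrite ?gpow_mx.
- by rewrite C6X -mono1; apply: mono1_eq.
- by rewrite C18X -mono1; apply: mono1_eq.
- by rewrite (H1E : H1 = Hs t12) expr2 -HsM t12K Hs1.
- by rewrite H3_Hs HsX t12t02_cube Hs1.
- by rewrite C6E C18E !mono_diagM; apply: mono1_eq.
- rewrite C6X C18X C6E mono_diagM (H1E : H1 = Hs t12).
  by apply: swap; apply: ord3P; rewrite !permE.
- rewrite C6X C18E mono_diagM (H1E : H1 = Hs t12).
  by apply: swap; apply: ord3P; rewrite !permE.
- rewrite C18X C6E mono_diagM H3_Hs.
  by apply: swap; apply: ord3P; rewrite permM !permE.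
- rewrite C18X C6E C18E mono_diagM H3_Hs.
  by apply: swap; apply: ord3P; rewrite permM !permE.
- rewrite H3_Hs HsX (H1E : H1 = Hs t12) -!HsM; congr Hs.
  rewrite expgS expg1 !mulgA t12K mul1g.
  by apply/permP; apply: ord3P; rewrite !permM !permE.
Qed.

Lemma mx_pres_rels : pres_rels mulMx 1 (fun x : Mx => x^-1) C6 C18 H1 H3.
Proof.
suff: C6 ^+ 6 = 1 /\ C18 ^+ 18 = 1 /\ C6 * C18 * (C6^-1 * C18^-1) = 1 /\
    H1 ^+ 2 = 1 /\ H3 ^+ 3 = 1 /\ (H1 * H3) ^+ 2 = 1 /\
    H1 * C6 * H1^-1 = C6^-1 * C18 ^+ 6 /\ H1 * C18 * H1^-1 = C6 ^+ 3 * C18 /\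
    H3 * C6 * H3^-1 = C6 * (C18 ^+ 3)^-1 /\ H3 * C18 * H3^-1 = C6 * C18 ^+ 10.
  by rewrite /pres_rels !gpow_mx.
have [] := mx_rewriting_rels; rewrite !gpow_mx => r6 r18 r1 r3.
move=> /= rc r16 r118 r36 r318 _.
have U6 : C6 \is a GRing.unit by rewrite C6E mono_unit.
have U18 : C18 \is a GRing.unit by rewrite C18E mono_unit.
have U1 : H1 \is a GRing.unit by rewrite H1E mono_unit.
have U3 : H3 \is a GRing.unit by rewrite H3_Hs mono_unit.
have conj_eq (h x y : Mx) : h \is a GRing.unit -> h * x = y * h -> h * x * h^-1 = y.
  by move=> uh ->; rewrite mulrK.
have C6V : C6^-1 = C6 ^+ 5 by apply: mulmx1_invr; rewrite -exprS r6.
have C18V : (C18 ^+ 3)^-1 = C18 ^+ 15 by apply: mulmx1_invr; rewrite -exprD r18.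
split; first exact: r6.
split; first exact: r18.
split; first by rewrite rc mulrA mulrK // mulrV.
split; first exact: r1.
split; first exact: r3.
split; first by rewrite -H0_H1H3 (H0E : H0 = Hs t02) expr2 -HsM t02K Hs1.
split; first by apply: conj_eq => //; rewrite C6V; exact: r16.
split; first by apply: conj_eq => //; exact: r118.
split; first by apply: conj_eq => //; rewrite C18V; exact: r36.
by apply: conj_eq => //; exact: r318.
Qed.

Lemma Fr648_nform (M : Mx) : Fr648 M <-> exists (x : 'I_18 * 'I_6 * ('I_2 * 'I_3)),
  nform mulMx 1 C6 C18 H1 H3 x.1.1 x.1.2 x.2.1 x.2.2 = M.
Proof.
split=> [/Fr648P[e [s [ade ->]]] | [[[i j] [a b]] <-]]; last first.
  apply: Fr648_gen_C; rewrite /nform !gpow_mx.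
  by do 2!apply: gen_mul; apply: gen_exp; apply: gen_base; rewrite !inE eqxx ?orbT.
rewrite mono_split; have [i [j ->]] := C_diagE ade.
have: exists (a : 'I_2) (b : 'I_3), Hs s = H1 ^+ a * H3 ^+ b; last first.
  by case=> a [b ->]; exists (i, j, (a, b)); rewrite /nform !gpow_mx.
have H11 : H1 * H1 = 1 by rewrite H1E -HsM t12K Hs1.
have: Hs s \in Hlist by apply/HlistP; exists s.
rewrite !inE H2E H4E.
(* The values are H0 = H1 H3, H2 = H1 H3^2 and H4 = H3^2. *)
case/or4P => [/eqP->|/eqP->|/eqP->|].
- by exists 0, 0; rewrite mulr1.
- by exists 1, 1; rewrite H3E /= mulrA H11 mul1r.
- by exists 1, 0; rewrite mulr1.
case/or3P => /eqP->.
- by exists 1, 2; rewrite /= expr1 expr2 H3E !mulrA H11 mul1r.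
- by exists 0, 1; rewrite mul1r.
- exists 0, 2; rewrite mul1r /= expr2 H3E H1E H0E -!HsM; congr Hs.
  by apply/permP; apply: ord3P; rewrite !permM !permE.
Qed.

Lemma nform_inj i j a b i' j' a' b' :
  nform mulMx 1 C6 C18 H1 H3 i j a b = nform mulMx 1 C6 C18 H1 H3 i' j' a' b' ->
  [/\ i = i' %[mod 18], j = j' %[mod 6], a = a' %[mod 2] & b = b' %[mod 3]].
Proof.
rewrite /nform !gpow_mx H1E -/(Hs _) H3_Hs !HsX -!HsM => /CC_inj[-> -> eq].
(* The sign of the permutation detects a modulo 2, since [t12] is odd and the 3-cycle [t12 * t02]
   even; cancelling the power of [t12] leaves b modulo 3. *)
have oddE m n : odd_perm (t12 ^+ m * (t12 * t02) ^+ n)%g = odd m.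
  have oddX (s : 'S_3) k : odd_perm (s ^+ k)%g = odd k && odd_perm s.
    elim: k => [|k IHk]; first by rewrite expg0 odd_perm1.
    by rewrite expgS odd_permM IHk /=; case: odd_perm; case: odd.
  by rewrite odd_permM !oddX odd_permM !odd_tperm andbF addbF andbT.
have eqa : a = a' %[mod 2] by rewrite !modn2 -(oddE a b) eq oddE.
split=> //.
have t12X : (t12 ^+ 2 = 1)%g by rewrite expgS expg1 t12K.
move: eq; rewrite -(expg_mod a t12X) eqa expg_mod // => /mulgI/eqP.
have order_t12t02 : #[t12 * t02]%g = 3%N.
  apply: nt_prime_order => //; first exact: t12t02_cube.
  by apply/eqP => /permP/(_ 0); rewrite !permM !permE.
by rewrite eq_expg_mod_order order_t12t02 => /eqP.
Qed.

(** * The homomorphism to any group satisfying the relations *)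

Section PresentationMap.
Variables (T : Type) (mul : T -> T -> T) (one : T) (inv : T -> T).
Hypothesis grpT : is_group mul one inv.
Variables c6 c18 h1 h3 : T.
Hypothesis relsT : pres_rels mul one inv c6 c18 h1 h3.

Local Notation gM := (nform mulMx 1 C6 C18 H1 H3).
Local Notation gT := (nform mul one c6 c18 h1 h3).

(* The value on matrices outside Fr648 is junk. *)
Definition pres_map (M : Mx) : T :=
  if [pick x : 'I_18 * 'I_6 * ('I_2 * 'I_3) | gM x.1.1 x.1.2 x.2.1 x.2.2 == M]
  is Some x then gT x.1.1 x.1.2 x.2.1 x.2.2 else one.

(** The choice made by [pick] is harmless: [nform_inj] makes the exponents of two normal forms of a
    matrix congruent, and [nform_mod] then equates their values in T. *)
Lemma pres_map_nform i j a b : pres_map (gM i j a b) = gT i j a b.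
Proof.
have [mulA mul1x mulx1 _ _] := grpT.
have relT := pres_rels_rewriting mulA mul1x mulx1 grpT relsT.
rewrite /pres_map; case: pickP => [[[i' j'] [a' b']] /eqP/nform_inj[] | nopick].
  exact: (nform_mod mulA mul1x relT).
have /Fr648_nform[x /eqP xP] : Fr648 (gM i j a b).
  apply: Fr648_gen_C; rewrite /nform !gpow_mx.
  by do 2!apply: gen_mul; apply: gen_exp; apply: gen_base; rewrite !inE eqxx ?orbT.
by rewrite nopick in xP.
Qed.

Lemma pres_mapM M N : Fr648 M -> Fr648 N ->
  pres_map (M * N) = mul (pres_map M) (pres_map N).
Proof.
have [mulA mul1x mulx1 _ _] := grpT.
have relT := pres_rels_rewriting mulA mul1x mulx1 grpT relsT.
have relM := mx_rewriting_rels.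
have [mA m1 m1r] : [/\ associative mulMx, left_id 1 mulMx & right_id 1 mulMx].
  by split; [exact: mulrA | exact: mul1r | exact: mulr1].
(* [step X x] says that left multiplication by X corresponds to left multiplication by x. It holds
   for the generators and passes to products and powers, hence to normal forms. *)
pose step X x :=
  forall N, Fr648 N -> Fr648 (X * N) /\ pres_map (X * N) = mul x (pres_map N).
have stepX X x n : step X x -> step (X ^+ n) (gpow mul one x n).
  move=> sX; elim: n => [|n IHn] P FP; first by rewrite expr0 mul1r mul1x.
  have [FXP eqXP] := IHn P FP; have [FP' eqP'] := sX _ FXP.
  by rewrite exprS -mulrA eqP' eqXP mulA.
have stepM X x Y y : step X x -> step Y y -> step (X * Y) (mul x y).
  move=> sX sY P FP; have [FYP eqYP] := sY P FP; have [FP' eqP'] := sX _ FYP.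
  by rewrite -mulrA eqP' eqYP mulA.
have gen_step X x : gen [:: C6; C18; H1; H3] X ->
    (forall i j a b, exists i' j' a' b',
      X * gM i j a b = gM i' j' a' b' /\ mul x (gT i j a b) = gT i' j' a' b') -> step X x.
  move=> FX act P FP; split; first by apply: gen_mul => //; apply: Fr648_gen_C.
  have [y <-] := (Fr648_nform P).1 FP.
  have [i' [j' [a' [b' [-> eqT]]]]] := act y.1.1 y.1.2 y.2.1 y.2.2.
  by rewrite !pres_map_nform.
have FC X : X \in [:: C6; C18; H1; H3] -> gen [:: C6; C18; H1; H3] X by exact: gen_base.
have s6 : step C6 c6.
  apply: gen_step => [|i j a b]; first by apply: FC; rewrite !inE eqxx ?orbT.
  exists i, j.+1, a, b; rewrite (mul_c6_nform mulA mul1x mulx1 relT).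
  by rewrite -(mul_c6_nform mA m1 m1r relM).
have s18 : step C18 c18.
  apply: gen_step => [|i j a b]; first by apply: FC; rewrite !inE eqxx ?orbT.
  exists i.+1, j, a, b; rewrite (mul_c18_nform _ mulA).
  by rewrite -(mul_c18_nform _ mA).
have s1 : step H1 h1.
  apply: gen_step => [|i j a b]; first by apply: FC; rewrite !inE eqxx ?orbT.
  do 4!eexists; rewrite (mul_h1_nform mulA mul1x mulx1 relT).
  by split; first exact: (mul_h1_nform mA m1 m1r relM).
have s3 : step H3 h3.
  apply: gen_step => [|i j a b]; first by apply: FC; rewrite !inE eqxx ?orbT.
  do 4!eexists; rewrite (mul_h3_nform mulA mul1x mulx1 relT).
  by split; first exact: (mul_h3_nform mA m1 m1r relM).
move=> /Fr648_nform[x <-] FN; rewrite pres_map_nform /nform !gpow_mx.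
have sM : step (C18 ^+ x.1.1 * C6 ^+ x.1.2 * (H1 ^+ x.2.1 * H3 ^+ x.2.2))
  (gT x.1.1 x.1.2 x.2.1 x.2.2).
  exact: (stepM _ _ _ _ (stepM _ _ _ _ (stepX _ _ _ s18) (stepX _ _ _ s6))
                        (stepM _ _ _ _ (stepX _ _ _ s1) (stepX _ _ _ s3))).
by have [_ ->] := sM N FN.
Qed.

Lemma pres_map_gens :
  [/\ pres_map C6 = c6, pres_map C18 = c18, pres_map H1 = h1 & pres_map H3 = h3].
Proof.
have [mulA mul1x mulx1 _ _] := grpT.
have E i j a b : pres_map (C18 ^+ i * C6 ^+ j * (H1 ^+ a * H3 ^+ b)) = gT i j a b.
  by rewrite -pres_map_nform /nform !gpow_mx.
split.
- by have := E 0 1 0 0; rewrite /nform /= !(mulr1, mul1r, mul1x, mulx1).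
- by have := E 1 0 0 0; rewrite /nform /= !(mulr1, mul1r, mul1x, mulx1).
- by have := E 0 0 1 0; rewrite /nform /= !(mulr1, mul1r, mul1x, mulx1).
- by have := E 0 0 0 1; rewrite /nform /= !(mulr1, mul1r, mul1x, mulx1).
Qed.

End PresentationMap.

Theorem theorem1 :
  (* Fr(162x4) is a subgroup of SU(3), finite of order 648 *)
  (forall M, Fr648 M -> M * adjM M = 1 /\ \det M = 1) /\
  has_order Fr648 648 /\
  (* Fr(162) is a subgroup of Fr(162x4), of order 162, isomorphic to D(9,1,1;2,1,1) *)
  (forall M, Fr162 M -> Fr648 M) /\
  has_order Fr162 162 /\
  (exists f : Mx -> Mx,
     [/\ forall M, Fr162 M -> Dgrp (f M),
         forall M, Dgrp M -> exists N, Fr162 N /\ f N = M,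
         forall M N, Fr162 M -> Fr162 N -> f M = f N -> M = N
       & forall M N, Fr162 M -> Fr162 N -> f (M * N) = f M * f N]) /\
  (* (a) NV is a normal subgroup, internal direct product of N and V, ~ Z18 x Z6 *)
  [/\ NV 1, (forall M N, NV M -> NV N -> NV (M * N)),
      (forall M, NV M -> NV M^-1),
      (forall M, NV M -> Fr648 M)
    & (forall g M, Fr648 g -> NV M -> NV (g * M * g^-1))] /\
  (forall N T, Ngrp N -> T \in Vlist -> N * T = T * N) /\
  (forall M, Ngrp M -> M \in Vlist -> M = 1) /\
  (exists f : 'Z_18 * 'Z_6 -> Mx,
     [/\ injective f, (forall M, NV M <-> exists x, f x = M)
       & forall a b c d, f (a + c, b + d) = f (a, b) * f (c, d)]) /\
  (* H is a subgroup isomorphic to S_3 *)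
  (forall M N, M \in Hlist -> N \in Hlist -> M * N \in Hlist) /\
  (forall M, M \in Hlist -> M^-1 \in Hlist) /\
  (exists f : 'S_3 -> Mx,
     [/\ injective f, (forall M, M \in Hlist <-> exists s, f s = M)
       & forall s t, f (s * t)%g = f s * f t]) /\
  (* NV /\ H = 1, and Fr(162x4) = NV . H *)
  (forall M, NV M -> M \in Hlist -> M = 1) /\
  (forall M, Fr648 M <-> exists X Y, NV X /\ Y \in Hlist /\ M = X * Y) /\
  (* (b) unique normal form *)
  (forall M, Fr648 M <->
     exists (i : 'I_9) (j : 'I_3) T Hm,
       [/\ T \in Vlist, Hm \in Hlist & M = Am ^+ i * Bm ^+ j * T * Hm]) /\
  (forall (i i' : 'I_9) (j j' : 'I_3) T T' Hm Hm',
     T \in Vlist -> T' \in Vlist -> Hm \in Hlist -> Hm' \in Hlist ->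
     Am ^+ i * Bm ^+ j * T * Hm = Am ^+ i' * Bm ^+ j' * T' * Hm' ->
     [/\ i = i', j = j', T = T' & Hm = Hm']) /\
  (* (c) presentation *)
  (forall M, Fr648 M <-> gen [:: C6; C18; H1; H3] M) /\
  pres_rels (fun x y : Mx => x * y) 1 (fun x : Mx => x^-1) C6 C18 H1 H3 /\
  (forall (T : Type) (mul : T -> T -> T) (one : T) (inv : T -> T),
     is_group mul one inv ->
     forall c6 c18 h1 h3 : T, pres_rels mul one inv c6 c18 h1 h3 ->
     exists f : Mx -> T,
       [/\ f C6 = c6, f C18 = c18, f H1 = h1, f H3 = h3
         & forall M N, Fr648 M -> Fr648 N -> f (M * N) = mul (f M) (f N)]).
Proof.
split; first by move=> M /Fr648P[e [s [ade ->]]]; rewrite mono_unitary mono_det.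
split; first exact: Fr648_order.
split.
  move=> M; apply: gen_sub => X; rewrite !inE => XG.
  by apply: gen_base; rewrite !inE orbA XG.
split; first exact: Fr162_order.
split.
  exists conjP; split.
  - exact: conjP_Fr162_Dgrp.
  - by move=> M DM; exists (conjP M); rewrite conjPK; split=> //; apply: conjP_Dgrp_Fr162.
  - by move=> M N _ _; apply: (can_inj conjPK).
  - by move=> M N _ _; apply: conjPM.
split; first exact: NV_subgroup.
split; first exact: N_V_commute.
split; first exact: N_V_trivial.
split; first exact: NV_Z18xZ6.
split; first exact: Hlist_mul.
split; first exact: Hlist_inv.
split; first by exists Hs; split; [exact: Hs_inj | exact: HlistP | exact: HsM].
split; first exact: NV_H_trivial.
split; first exact: Fr648_NV_H.
split; first exact: Fr648_normal_form.
split; first exact: Fr648_normal_form_uniq.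
split.
  by move=> M; split=> [/Fr648P/monomial_in_gen_C | /Fr648_gen_C].
split; first exact: mx_pres_rels.
move=> T mul one inv grpT c6 c18 h1 h3 relsT.
exists (pres_map mul one c6 c18 h1 h3).
have [e6 e18 e1 e3] := pres_map_gens grpT relsT.
by split=> // M N; exact: (pres_mapM grpT relsT).
Qed.
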